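(* Let $S$ be an additively divisible (commutative) semiring. If $S$ is torsion and finitely generated (as a semiring), then $S$ is additively idempotent.
   Context: A semiring is a non-empty set with two commutative and associative binary operations, addition and multiplication, such that multiplication distributes over addition; no additively or multiplicatively neutral element is assumed. $\mathbb{N}$ denotes the positive integers. For $a\in S$ and $k\in\mathbb{N}$, $ka$ is the sum of $k$ copies of $a$. $S$ is additively divisible if for every $a\in S$ and every $n\in\mathbb{N}$ there is $b\in S$ with $a=nb$. An element $a$ has finite order if the set $\{ka : k\in\mathbb{N}\}$ is finite; $S$ is torsion if every element of $S$ has finite order. $S$ is additively idempotent if $a+a=a$ for every $a\in S$. *)

(* Defs.v *)
From HB Require Import structures.
From mathcomp Require Import all_boot all_order all_algebra all_classical.

Set Implicit Arguments.
Unset Strict Implicit.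
Unset Printing Implicit Defensive.

Import GRing.Theory.
Local Open Scope classical_set_scope.
Local Open Scope ring_scope.

(* MathComp's pzSemiRingType demands both a 0 and a 1; here neither neutral
   element is assumed, so the structure is built over addSemigroupType
   (commutative and associative addition). *)
HB.mixin Record AddSemigroup_isComSemiring S of Algebra.AddSemigroup S := {
  semiring_nonempty : exists x : S, True;
  smul : S -> S -> S;
  smulC : commutative smul;
  smulA : associative smul;
  smulDr : right_distributive smul (@Algebra.add S)
}.

#[short(type="comSemiringType")]
HB.structure Definition ComSemiring :=
  {S of AddSemigroup_isComSemiring S & Algebra.AddSemigroup S}.

Section ComSemiringDefs.
Variable S : comSemiringType.
Implicit Types (a b : S) (k n : nat) (A X : set S).

(* posmul k a = a + (a + ... + a), with k copies of a. There is no 0 in S: the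
   value a at k = 0 is junk, and every use below is restricted to 0 < k. *)
Definition posmul k a : S := iterop k (@Algebra.add S) a a.

Definition additively_divisible :=
  forall a n, (0 < n)%N -> exists b, a = posmul n b.

Definition finite_order a :=
  finite_set [set posmul k a | k in [set k | (0 < k)%N]].

Definition torsion := forall a, finite_order a.

Definition additively_idempotent := forall a, a + a = a.

(* The empty set is allowed here, so that the empty set generates set0. As S is
   nonempty, this does not affect which S are finitely generated. *)
Definition subsemiring_closed A :=
  (forall a b, A a -> A b -> A (a + b)) /\
  (forall a b, A a -> A b -> A (smul a b)).

Definition finitely_generated :=
  exists2 X, finite_set X & smallest subsemiring_closed X = setT.

End ComSemiringDefs.

Arguments additively_divisible S : clear implicits.
Arguments torsion S : clear implicits.
Arguments additively_idempotent S : clear implicits.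
Arguments finitely_generated S : clear implicits.

(* Main.v *)
From mathcomp Require Import all_boot all_algebra all_classical.
Require Import Defs.

(* Finite order gives each generator [x] some [q > 0] with [q x] additively
   idempotent. A common [q] for the finitely many generators works for all of
   [S], since the [a] with [q a] idempotent form a subsemiring. Any [a] is
   [q b] for some [b], hence idempotent. *)

Set Implicit Arguments.
Unset Strict Implicit.
Unset Printing Implicit Defensive.

Local Open Scope classical_set_scope.
Local Open Scope ring_scope.

Section Posmul.
Variable S : comSemiringType.
Implicit Types (a b : S) (k l m n : nat).

Lemma posmulS k a : (0 < k)%N -> posmul k.+1 a = a + posmul k a.
Proof. by case: k. Qed.

Lemma posmulD k l a : (0 < k)%N -> (0 < l)%N ->
  posmul (k + l) a = posmul k a + posmul l a.
Proof.
move=> + l0; case: k => // k _; elim: k => [|k IHk]; first exact: posmulS.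
by rewrite addSn posmulS// IHk Algebra.addrA -posmulS.
Qed.

Lemma posmulM k l a : (0 < k)%N -> (0 < l)%N ->
  posmul (k * l) a = posmul k (posmul l a).
Proof.
move=> + l0; case: k => // k _; elim: k => [|k IHk]; first by rewrite mul1n.
by rewrite mulSn posmulD ?muln_gt0// IHk -posmulS.
Qed.

Lemma posmulDr k a b : (0 < k)%N -> posmul k (a + b) = posmul k a + posmul k b.
Proof.
case: k => // k _; elim: k => // k IHk.
by rewrite !(posmulS _ (ltn0Sn k)) IHk Algebra.addrACA.
Qed.

Lemma smul_posmul k a b : (0 < k)%N -> smul a (posmul k b) = posmul k (smul a b).
Proof.
case: k => // k _; elim: k => // k IHk.
by rewrite !(posmulS _ (ltn0Sn k)) smulDr IHk.
Qed.

Lemma posmul_idem k a : (0 < k)%N -> a + a = a -> posmul k a = a.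
Proof.
case: k => // k _ aa; elim: k => // k IHk.
by rewrite posmulS// IHk.
Qed.

(** Pigeonhole: without a repetition, the positive multiples of [a] would be pairwise distinct,
    hence infinitely many. *)
Lemma finite_order_repeat a : finite_order a ->
  exists m n, [/\ (0 < m)%N, (0 < n)%N & posmul (m + n) a = posmul m a].
Proof.
move=> fin_a; apply: contrapT => no_repeat.
(* The shift avoids the junk value [posmul 0 a], which equals [posmul 1 a] and would spoil
   injectivity. *)
pose f n := posmul n.+1 a.
have f_lt i j : (i < j)%N -> f i <> f j.
  move=> ij fij; apply: no_repeat; exists i.+1, (j - i)%N.
  by rewrite subn_gt0 addSn subnKC ?(ltnW ij).
have f_inj : injective f.
  move=> i j fij; case: (ltngtP i j) => // /f_lt; first by case.
  by move=> /(_ (esym fij)).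
apply: infinite_nat.
have := finite_preimage (in2W f_inj) fin_a; congr (finite_set _).
by apply/seteqP; split => // n _; exists n.+1.
Qed.

(** From index [m] on, the multiples of [a] have period [n]; a multiple of [n] that reaches the
    index, such as [n * m], gives an idempotent. *)
Lemma finite_order_idem a : finite_order a ->
  exists2 q, (0 < q)%N & posmul q a + posmul q a = posmul q a.
Proof.
move=> /finite_order_repeat [m [n [m0 n0 mnE]]].
have absorb l : (0 < l)%N -> posmul m a + posmul (l * n) a = posmul m a.
  case: l => // l _; elim: l => [|l IHl]; first by rewrite mul1n -posmulD.
  by rewrite mulSn posmulD ?muln_gt0// Algebra.addrA -posmulD// mnE.
exists (n * m)%N; first by rewrite muln_gt0 n0.
(* The first summand and the right-hand side are read as [n] copies of [posmul m a]; one copy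
   absorbs the second summand, a multiple of the period. *)
have {2}-> : (n * m = m * n)%N by exact: mulnC.
rewrite posmulM//; case: n n0 absorb {mnE} => // -[|n] _ /(_ m m0) absorb //.
by rewrite posmulS// Algebra.addrAC absorb.
Qed.

Lemma posmulM_idem k l a : (0 < k)%N -> (0 < l)%N ->
  posmul l a + posmul l a = posmul l a ->
  posmul (k * l) a + posmul (k * l) a = posmul (k * l) a.
Proof. by move=> k0 l0 idem; rewrite posmulM// posmul_idem. Qed.

(** Multiples of a good exponent stay good, so the exponents of the listed elements can be
    multiplied together. *)
Lemma torsion_uniform_idem (s : seq S) : torsion S ->
  exists2 q, (0 < q)%N &
    forall x, x \in s -> posmul q x + posmul q x = posmul q x.
Proof.
move=> torS; elim: s => [|x s [q q0 qidem]]; first by exists 1%N.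
have [p p0 pidem] := finite_order_idem (torS x).
exists (p * q)%N => [|y]; first by rewrite muln_gt0 p0.
rewrite inE => /predU1P[->|/qidem]; last exact: posmulM_idem.
by rewrite mulnC; exact: posmulM_idem.
Qed.

Lemma posmul_idem_subsemiring q : (0 < q)%N ->
  subsemiring_closed [set a : S | posmul q a + posmul q a = posmul q a].
Proof.
move=> q0; split=> a b /= aidem bidem.
  by rewrite posmulDr// Algebra.addrACA aidem bidem.
(* The multiple moves onto the right factor: [q(ab) = a(qb)], and [a(qb) + a(qb) = a(qb + qb)]. *)
by rewrite -smul_posmul// -smulDr bidem.
Qed.

End Posmul.

Theorem corollary3p3 (S : comSemiringType)
    (divS : additively_divisible S)
    (torS : torsion S)
    (fgS : finitely_generated S) :
  additively_idempotent S.
Proof.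
case: fgS => X /finite_seqP[s ->] genS a.
have [q q0 sidem] := torsion_uniform_idem s torS.
have [b ->] := divS a q q0.
suff : [set: S] `<=` [set a | posmul q a + posmul q a = posmul q a] by apply.
by rewrite -genS; apply: smallest_sub; first exact: posmul_idem_subsemiring.
Qed.
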